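(* There is an absolute constant $\delta>0$ such that for all integers $1\le k\le n$ and all vectors $u_1,\ldots,u_n\in\mathbb{R}^k$ with $|u_i|\le 1$ for every $i$, $$\Big|\{x\in\mathbb{R}^k:\ |\langle x,u_i\rangle|\le 1\text{ for every } i\}\Big|^{1/k}\ \ge\ \frac{\delta}{\sqrt{1+\log\frac nk}}.$$
   Context: $|u|$ denotes the Euclidean norm, $\langle\cdot,\cdot\rangle$ the standard inner product, $\log$ the natural logarithm, and $|K|$ the $k$-dimensional Lebesgue measure of $K\subset\mathbb{R}^k$. *)

(* Defs.v *)
From HB Require Import structures.
From mathcomp Require Import all_boot all_order all_algebra.
From mathcomp Require Import all_classical all_reals all_analysis.
From mathcomp Require Import Rstruct Rstruct_topology.
From Stdlib Require Import Rdefinitions.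

Set Implicit Arguments.
Unset Strict Implicit.
Unset Printing Implicit Defensive.

Import Order.TTheory GRing.Theory Num.Theory.
Local Open Scope classical_set_scope.
Local Open Scope ring_scope.

Definition dotR (k : nat) (x y : 'rV[R]_k) : R := \sum_(j < k) x ord0 j * y ord0 j.

Definition enorm (k : nat) (x : 'rV[R]_k) : R := Num.sqrt (dotR x x).

Definition box (k : nat) (a b : 'rV[R]_k) : set 'rV[R]_k :=
  [set x | forall j : 'I_k, a ord0 j <= x ord0 j <= b ord0 j].

Definition boxvol (k : nat) (a b : 'rV[R]_k) : R :=
  \prod_(j < k) Num.max 0 (b ord0 j - a ord0 j).

(* k-dimensional Lebesgue (outer) measure: infimum of total volumes of countable
   covers by boxes.  It agrees with Lebesgue measure on measurable sets. *)
Definition leb_vol (k : nat) (A : set 'rV[R]_k) : \bar R :=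
  ereal_inf [set s : \bar R | exists (a b : nat -> 'rV[R]_k),
     A `<=` \bigcup_m box (a m) (b m) /\
     s = (\sum_(0 <= m <oo) (boxvol (a m) (b m))%:E)%E].

Definition slab_body (k n : nat) (u : 'I_n -> 'rV[R]_k) : set 'rV[R]_k :=
  [set x | forall i : 'I_n, `|dotR x (u i)| <= 1].

(* Main.v *)
(** Partition [-1, 1]^k into cells according to the nearest integers to
    <x, u_i> / w, where w = 8 sqrt L and L = 1 + log (n / k).  Two points of a
    common cell differ by a vector of w K, with K the slab body, so it suffices
    to find a cell of volume at least exp(- C k).  For x uniform in the cube each
    <x, u_i> is subgaussian, so the nearest integers N_i satisfy
    E (sum_i |N_i|) <= 2 k / L.  Give a cell the weight
    prod_i exp(- L |N_i|): all weights sum to at most exp(4 k), while by Jensen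
    the mean weight of the cell of x is at least exp(- 2 k); hence some cell has
    probability at least exp(- 6 k).  The cube is replaced throughout by a fine
    grid, and volumes are recovered by counting grid points in a finite subcover
    and letting the mesh tend to 0. *)

Require Import Defs.
From HB Require Import structures.
From mathcomp Require Import all_boot all_order all_algebra.
From mathcomp Require Import all_classical all_reals all_analysis.
From mathcomp Require Import Rstruct Rstruct_topology.
From mathcomp Require Import exp ring lra.
From Stdlib Require Import Rdefinitions.
Import Order.TTheory GRing.Theory Num.Theory.
Import numFieldNormedType.Exports.
Local Open Scope classical_set_scope.
Local Open Scope ring_scope.

Set Implicit Arguments.
Unset Strict Implicit.
Unset Printing Implicit Defensive.

(** * Subgaussian bounds on the grid *)

(** The inequality [1 + s <= expR s] at [- s] gives [expR s <= (1 - s)^-1] for [|s| < 1]. The two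
    bounds add up to [2 / (1 - t^2)], which is at most [2 (1 + 2 t^2)] as long as [t^2 <= 1/2]. *)
Lemma expR_addN_le_small (R : realType) (t : R) : t ^+ 2 <= 2^-1 ->
  expR t + expR (- t) <= 2 * expR (2 * t ^+ 2).
Proof.
move=> t2.
have tlt1 : `|t| < 1.
  by rewrite -(@ltr_pXn2r _ 2) ?nnegrE// real_normK ?num_real// expr1n; lra.
have [tl tu] : - 1 < t /\ t < 1 by move: tlt1; rewrite ltr_norml => /andP[].
have inv_bound (s : R) : -1 < s -> s < 1 -> expR s <= (1 - s)^-1.
  move=> s1 s2; rewrite -[s in expR s]opprK expRN lef_pV2 ?posrE ?expR_gt0 ?subr_gt0//.
  exact: expR_ge1Dx.
have h1 := inv_bound t tl tu.
have h2 := inv_bound (- t) ltac:(lra) ltac:(lra).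
apply: (le_trans (lerD h1 h2)).
have -> : (1 - t)^-1 + (1 - - t)^-1 = 2 * (1 - t ^+ 2)^-1.
  by field; rewrite !lt0r_neq0//; nra.
rewrite ler_pM2l//.
apply: le_trans (expR_ge1Dx _).
rewrite -div1r ler_pdivrMr; nra.
Qed.

(* The doubling [cosh (2 t) = 2 cosh t ^ 2 - 1] preserves the bound, as
   [2 y - 1 <= y ^ 2]. *)
Lemma expR_addN_le (R : realType) (t : R) : expR t + expR (- t) <= 2 * expR (2 * t ^+ 2).
Proof.
suff main (n : nat) (s : R) : s ^+ 2 <= 4 ^+ n / 2 ->
    expR s + expR (- s) <= 2 * expR (2 * s ^+ 2).
  (* With this [n], [2 t^2 < n <= 4^n]. *)
  apply: (main (Num.trunc (2 * t ^+ 2)).+1).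
  rewrite ler_pdivlMr// mulrC; apply/ltW/(lt_le_trans (truncnS_gt _)).
  by rewrite -natrX ler_nat ltnW// ltn_expl.
elim: n s => [s|n ih s hs]; first by rewrite expr0 mul1r; exact: expR_addN_le_small.
have [r rE] : exists r, s = r + r by exists (s / 2); field.
have : r ^+ 2 <= 4 ^+ n / 2.
  have -> : r ^+ 2 = s ^+ 2 / 4 by rewrite rE; field.
  by rewrite ler_pdivrMr// mulrC mulrA -exprS.
move=> /ih; rewrite rE.
have -> : - (r + r) = - r + - r by ring.
have -> : 2 * (r + r) ^+ 2 = 2 * r ^+ 2 * 4%:R by ring.
rewrite expRM_natr !expRD.
have := expR_gt0 (2 * r ^+ 2); have := expR_gt0 r; have := expR_gt0 (- r).
have : expR r * expR (- r) = 1 by rewrite -expRD subrr expR0.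
set a := expR r; set b := expR (- r); set y := expR _.
move=> ab b0 a0 y0 h.
have h2 : (a + b) ^+ 2 <= (2 * y) ^+ 2 by rewrite ler_pXn2r// nnegrE; lra.
have : 0 <= (y ^+ 2 - 1) ^+ 2 by exact: sqr_ge0.
have -> : (y ^+ 2 - 1) ^+ 2 = y ^+ 4 - 2 * y ^+ 2 + 1 by ring.
nra.
Qed.

Lemma ler_expR_norm (R : realType) (t : R) : expR `|t| <= expR t + expR (- t).
Proof.
have := expR_gt0 t; have := expR_gt0 (- t).
by case: (ger0P t) => *; lra.
Qed.

(* Midpoints of the subdivision of [[-1, 1]] into [m] equal intervals. *)
Definition midpoint {R : realType} {m : nat} (z : 'I_m) : R := (2 * z%:R + 1) / m%:R - 1.

Lemma midpoint_rev (R : realType) m (z : 'I_m) :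
  midpoint (rev_ord z) = - midpoint z :> R.
Proof.
have m0 : (0 < m)%nat by case: m z => [[]|].
have : (m%:R : R) != 0 by rewrite pnatr_eq0 -lt0n.
rewrite /midpoint /= natrB ?ltn_ord// -[z.+1%:R]natr1  => ?; by field.
Qed.

Lemma midpoint_norm_le1 (R : realType) m (z : 'I_m) : `|midpoint z| <= 1 :> R.
Proof.
have m0 : (0 < m)%nat by case: m z => [[]|].
have m0' : 0 < (m%:R : R) by rewrite ltr0n.
have : (z.+1%:R : R) <= m%:R by rewrite ler_nat ltn_ord.
have : 0 <= (z%:R : R) by [].
rewrite -[z.+1%:R]natr1 => z0 zm.
rewrite ler_norml /midpoint lerBrDr lerBlDr addNr; apply/andP; split.
  by rewrite divr_ge0//.
by rewrite ler_pdivrMr//; lra.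
Qed.

(** Reversing the order negates the midpoints, so twice the sum is a sum of terms
    [expR t + expR (- t)] with [|t| <= |s|]. *)
Lemma sum_expR_midpoint (R : realType) m (s : R) :
  \sum_(z < m) expR (s * midpoint z) <= m%:R * expR (2 * s ^+ 2).
Proof.
rewrite -(ler_pM2l (ltr0n R 2)) [leLHS]mulr_natl mulr2n.
rewrite {2}(reindex_inj rev_ord_inj)/= -big_split/=.
apply: (@le_trans _ _ (\sum_(z < m) 2 * expR (2 * s ^+ 2))); last first.
  by rewrite sumr_const card_ord -mulr_natl; lra.
apply: ler_sum => z _; rewrite midpoint_rev mulrN.
apply: (le_trans (expR_addN_le _)); rewrite ler_pM2l// ler_expR ler_pM2l//.
rewrite exprMn ler_piMr ?sqr_ge0// -real_normK ?num_real//.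
by rewrite expr_le1 ?midpoint_norm_le1.
Qed.

Definition gridpt {k m : nat} (z : {ffun 'I_k -> 'I_m}) : 'rV[R]_k :=
  \row_j midpoint (z j).

(** A crude bound, meant to confine the rounded products to a finite range so that their codes form
    a finite type. *)
Lemma dotR_gridpt_norm k m (z : {ffun 'I_k -> 'I_m}) (u : 'rV[R]_k) :
  enorm u <= 1 -> `|dotR (gridpt z) u| <= k%:R.
Proof.
move=> u1; rewrite /dotR.
have uu : dotR u u <= 1 by rewrite -ler_sqrt ?ler01// sqrtr1.
apply: (le_trans (ler_norm_sum _ _ _)).
apply: (@le_trans _ _ (\sum_(j < k) 1)); last by rewrite sumr_const card_ord.
apply: ler_sum => j _; rewrite mxE normrM.
apply: mulr_ile1 => //; first exact: midpoint_norm_le1.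
rewrite -(@ler_pXn2r _ 2) ?nnegrE// real_normK ?num_real// expr1n.
apply: le_trans uu; rewrite /dotR (bigD1 j)//= expr2 lerDl.
by apply: sumr_ge0 => i _; rewrite -expr2 sqr_ge0.
Qed.

(** The coordinates of a grid point vary independently, so the sum factors into one-dimensional
    ones, and the exponents add up through [dotR u u <= 1]. *)
Lemma sum_expR_gridpt k m (t : R) (u : 'rV[R]_k) : enorm u <= 1 ->
  \sum_(z : {ffun 'I_k -> 'I_m}) expR (t * dotR (gridpt z) u)
    <= m%:R ^+ k * expR (2 * t ^+ 2).
Proof.
move=> u1.
have uu : dotR u u <= 1 by rewrite -ler_sqrt ?ler01// sqrtr1.
have -> : \sum_(z : {ffun 'I_k -> 'I_m}) expR (t * dotR (gridpt z) u) =
    \prod_(j < k) \sum_(z < m) expR (t * u ord0 j * midpoint z).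
  rewrite bigA_distr_bigA/=; apply: eq_bigr => z _.
  rewrite /dotR mulr_sumr expR_sum; apply: eq_bigr => j _.
  by rewrite mxE; congr expR; ring.
apply: (@le_trans _ _ (\prod_(j < k) (m%:R * expR (2 * (t * u ord0 j) ^+ 2)))).
  apply: ler_prod => j _; rewrite sum_expR_midpoint andbT.
  by apply: sumr_ge0 => z _; rewrite expR_ge0.
rewrite big_split/= prodr_const card_ord -expR_sum ler_wpM2l ?exprn_ge0//.
rewrite ler_expR -mulr_sumr ler_pM2l//.
under eq_bigr do rewrite exprMn.
by rewrite -mulr_sumr ler_piMr ?sqr_ge0.
Qed.

(** * A cell with many grid points *)

(** The graph of [expR] lies above its tangent at [- mu]; summing this over [z] leaves a nonnegative
    linear term. *)
Lemma expR_Jensen (R : realType) (T : finType) (Z : T -> R) (mu : R) :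
  \sum_z Z z <= #|T|%:R * mu ->
  #|T|%:R * expR (- mu) <= \sum_z expR (- Z z).
Proof.
move=> hZ.
apply: (@le_trans _ _ (\sum_z expR (- mu) * (1 + (mu - Z z)))).
  rewrite -mulr_sumr mulrC ler_wpM2l ?expR_ge0// big_split/= sumrB !sumr_const.
  by rewrite lerDl subr_ge0 -[mu *+ _]mulr_natl.
apply: ler_sum => z _.
have -> : expR (- Z z) = expR (- mu) * expR (mu - Z z).
  by rewrite -expRD; congr expR; ring.
by rewrite ler_wpM2l ?expR_ge0// expR_ge1Dx.
Qed.

(** Take for [c] the value with the largest fibre: every fibre then contributes at most that size
    times its weight. *)
Lemma weighted_pigeonhole (R : realType) (T C : finType) (f : T -> C) (q : C -> R) (c0 : C) :
  (forall c, 0 <= q c) ->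
  exists c, \sum_x q (f x) <= #|[set x | f x == c]%SET|%:R * \sum_c q c.
Proof.
move=> q0; pose F c := #|[set x | f x == c]%SET|.
have [c _ cmax] := @arg_maxnP _ c0 xpredT F isT; exists c.
rewrite (partition_big f xpredT)//= mulr_sumr; apply: ler_sum => d _.
rewrite (eq_bigr (fun=> q d)); last by move=> x /eqP ->.
rewrite sumr_const -[q d *+ _]mulr_natl ler_wpM2r// ler_nat.
by apply: leq_trans (cmax d isT); rewrite /F cardsE.
Qed.

(** Absolute value of the integer nearest to [s]; the sign is kept by [rounding_code]. *)
Definition rounding {R : realType} (s : R) : nat := Num.trunc (`|s| + 2^-1).

(* [None] encodes the nearest integer [0], and [Some (b, j)] encodes [± j.+1];
   [j <= B] is not enforced but holds when [|s| <= B]. *)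
Definition rounding_code {R : realType} (B : nat) (s : R) : option (bool * 'I_B.+1) :=
  if rounding s is j.+1 then Some (s < 0, inord j) else None.

Definition code_size (B : nat) (c : option (bool * 'I_B.+1)) : nat :=
  if c is Some (_, j) then j.+1 else 0.

Lemma rounding_itv (R : realType) (s : R) :
  (rounding s)%:R <= `|s| + 2^-1 < (rounding s).+1%:R.
Proof. by apply: truncn_itv; rewrite addr_ge0. Qed.

Lemma rounding_lt (R : realType) (B : nat) (s : R) : `|s| <= B%:R -> (rounding s < B.+1)%nat.
Proof.
move=> sB; rewrite -(ltr_nat R) -[B.+1%:R]natr1.
have /andP[] := rounding_itv s; lra.
Qed.

Lemma code_sizeE (R : realType) (B : nat) (s : R) : `|s| <= B%:R ->
  code_size (rounding_code B s) = rounding s.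
Proof.
move/rounding_lt; rewrite /code_size /rounding_code.
by case: (rounding s) => // j jB; rewrite inordK// ltnW.
Qed.

(** A code determines an interval of length 1: the one centred at 0 for [None], and otherwise one on
    the side fixed by the sign. *)
Lemma rounding_code_close (R : realType) (B : nat) (s t : R) :
  `|s| <= B%:R -> `|t| <= B%:R ->
  rounding_code B s = rounding_code B t -> `|s - t| <= 1.
Proof.
move=> sB tB st.
have : rounding s = rounding t by rewrite -(code_sizeE sB) st code_sizeE.
move: st; rewrite /rounding_code.
have /andP[s1 s2] := rounding_itv s; have /andP[t1 t2] := rounding_itv t.
case: (rounding s) s1 s2 => [|j] s1 s2; case: (rounding t) t1 t2 => [|i] // t1 t2.
  move=> _ _; move: s2 t2; rewrite ler_norml.
  by case: (ger0P s); case: (ger0P t) => *; apply/andP; split; lra.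
move=> [sgn _] [ij]; move: s1 s2 sgn; rewrite {j}ij => s1 s2.
move: s1 s2 t1 t2; rewrite -[i.+2%:R]natr1; set r := i.+1%:R.
by rewrite ler_norml; case: (ger0P s); case: (ger0P t) => *; apply/andP; split; lra.
Qed.

(** Exponential Markov bound. A positive rounding forces [|s| >= 1/2], and then
    [1 + b (|s| - 1/2) >= |s| + 1/2]. *)
Lemma rounding_le_expR (R : realType) (b s : R) : 1 <= b ->
  (rounding s)%:R <= expR (b * (`|s| - 2^-1)).
Proof.
move=> b1; have /andP[h _] := rounding_itv s.
case: (rounding s) h => [|j] h; first exact: expR_ge0.
apply: le_trans (expR_ge1Dx _).
have : 1 <= (j.+1%:R : R) by rewrite ler1n.
nra.
Qed.

(** A geometric series for each sign: with [r = expR (- L) <= 1/2] the total is at most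
    [1 + 4 r]. *)
Lemma sum_code_weight (R : realType) (B : nat) (L : R) : 1 <= L ->
  \sum_(c : option (bool * 'I_B.+1)) expR (- (L * (code_size c)%:R))
    <= expR (4 * expR (- L)).
Proof.
move=> L1; set r := expR (- L).
have r0 : 0 < r by exact: expR_gt0.
have r2 : r <= 2^-1.
  rewrite /r expRN lef_pV2 ?posrE ?expR_gt0//.
  by apply: le_trans (expR_ge1Dx _); lra.
have geo n : \sum_(j < n) r ^+ j.+1 <= 2 * r.
  elim: n => [|n ih]; first by rewrite big_ord0; lra.
  rewrite big_ord_recl/= expr1.
  under eq_bigr do rewrite /bump/= add1n exprS.
  rewrite -mulr_sumr; nra.
have -> : \sum_(c : option (bool * 'I_B.+1)) expR (- (L * (code_size c)%:R)) =
    1 + 2 * \sum_(j < B.+1) r ^+ j.+1.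
  rewrite (bigD1 None)//= mulr0 oppr0 expR0; congr (1 + _).
  rewrite (reindex_omap Some id) => [|[]]//=.
  rewrite (eq_bigl xpredT) => [|x]; last by rewrite eqxx.
  rewrite (eq_bigr (fun x : bool * 'I_B.+1 => r ^+ x.2.+1)) => [|[b j] _]; last first.
    by rewrite /code_size -mulNr expRM_natr.
  rewrite -(pair_bigA _ (fun (b : bool) (j : 'I_B.+1) => r ^+ j.+1))/=.
  by rewrite sumr_const card_bool mulr_natl.
apply: le_trans (expR_ge1Dx _).
have := geo B.+1; lra.
Qed.

(** Taking [b = 8 L] in [rounding_le_expR] yields a factor [expR (- 4 L)] and exponential moments at
    [t] and [- t], where [t] equals [sqrt L]; each moment costs [expR (2 L)]. *)
Lemma sum_rounding_gridpt k m (L : R) (u : 'rV[R]_k) : 1 <= L -> enorm u <= 1 ->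
  \sum_(z : {ffun 'I_k -> 'I_m})
      (rounding (dotR (gridpt z) u / (8 * Num.sqrt L)))%:R
    <= m%:R ^+ k * (2 * expR (- (2 * L))).
Proof.
move=> L1 u1; set w := 8 * Num.sqrt L; set t := 8 * L / w.
have sL : 1 <= Num.sqrt L by rewrite -[leLHS]sqrtr1 ler_sqrt; lra.
have w0 : 0 < w by rewrite /w; lra.
have w2 : w ^+ 2 = 64 * L by rewrite /w exprMn sqr_sqrtr; [ring|lra].
have t2 : 2 * t ^+ 2 = 2 * L.
  rewrite /t expr_div_n w2; field; lra.
apply: (@le_trans _ _ (\sum_(z : {ffun 'I_k -> 'I_m}) expR (- (4 * L)) *
    (expR (t * dotR (gridpt z) u) + expR (- t * dotR (gridpt z) u)))).
  apply: ler_sum => z _.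
  have L8 : 1 <= 8 * L by lra.
  apply: (le_trans (rounding_le_expR _ L8)).
  have -> : 8 * L * (`|dotR (gridpt z) u / w| - 2^-1) =
      - (4 * L) + `|t * dotR (gridpt z) u|.
    rewrite [`|t * _|]normrM [`|_ / w|]normrM normfV (gtr0_norm w0) [`|t|]ger0_norm; last first.
      by rewrite /t divr_ge0 ?ltW//; lra.
    by rewrite /t; field; rewrite gt_eqF.
  by rewrite expRD ler_wpM2l ?expR_ge0// mulNr ler_expR_norm.
rewrite -mulr_sumr big_split/=.
have h1 := sum_expR_gridpt m t u1; have h2 := sum_expR_gridpt m (- t) u1.
rewrite sqrrN in h2; rewrite t2 in h1 h2.
apply: (@le_trans _ _ (expR (- (4 * L)) *
    (m%:R ^+ k * expR (2 * L) + m%:R ^+ k * expR (2 * L)))).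
  by rewrite ler_wpM2l ?expR_ge0// lerD.
have -> : - (2 * L) = - (4 * L) + 2 * L by ring.
rewrite [expR (_ + _)]expRD.
by move: (expR _) (expR _) (_ ^+ k) => a b c; lra.
Qed.

Lemma exists_large_cell k n m (L : R) (u : 'I_n -> 'rV[R]_k) :
  1 <= L -> n%:R * expR (- L) <= k%:R -> (forall i, enorm (u i) <= 1) ->
  exists S : {set {ffun 'I_k -> 'I_m}},
    m%:R ^+ k * expR (- 6) ^+ k <= #|S|%:R :> R /\
    forall y z, y \in S -> z \in S -> forall i,
      `|dotR (gridpt y) (u i) - dotR (gridpt z) (u i)| <= 8 * Num.sqrt L.
Proof.
move=> L1 nL u1; set w := 8 * Num.sqrt L.
have sL : 1 <= Num.sqrt L by rewrite -[leLHS]sqrtr1 ler_sqrt; lra.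
have w1 : 1 <= w by rewrite /w; lra.
have w0 : 0 < w by lra.
pose s i (z : {ffun 'I_k -> 'I_m}) := dotR (gridpt z) (u i) / w.
have sk i z : `|s i z| <= k%:R.
  rewrite /s normrM normfV (gtr0_norm w0) ler_pdivrMr//.
  by apply: (le_trans (dotR_gridpt_norm z (u1 i))); rewrite ler_peMr.
pose f z := [ffun i => rounding_code k (s i z)].
pose q (c : {ffun 'I_n -> option (bool * 'I_k.+1)}) : R :=
  \prod_i expR (- (L * (code_size (c i))%:R)).
have q0 c : 0 <= q c by apply: prodr_ge0 => i _; rewrite expR_ge0.
have [c hc] := weighted_pigeonhole f [ffun=> None] q0.
exists [set z | f z == c]%SET; split; last first.
  move=> y z; rewrite !inE => /eqP yc /eqP zc i.
  have : rounding_code k (s i y) = rounding_code k (s i z).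
    by have := congr1 (fun g : {ffun _ -> _} => g i) (etrans yc (esym zc)); rewrite !ffunE.
  move/(rounding_code_close (sk i y) (sk i z)).
  by rewrite /s -mulrBl normrM normfV (gtr0_norm w0) ler_pdivrMr// mul1r.
(* The total weight factors over [i], with exponent [4 n expR (- L) <= 4 k]. *)
have sum_q : \sum_c q c <= expR 4 ^+ k.
  rewrite /q -(bigA_distr_bigA (fun (i : 'I_n) (c : option (bool * 'I_k.+1)) =>
     expR (- (L * (code_size c)%:R))))/=.
  apply: (@le_trans _ _ (\prod_(i < n) expR (4 * expR (- L)))).
    apply: ler_prod => i _; rewrite sum_code_weight// andbT.
    by apply: sumr_ge0 => d _; rewrite expR_ge0.
  rewrite prodr_const card_ord -!expRM_natl ler_expR mulrCA [leRHS]mulrC.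
  by rewrite ler_pM2l.
pose Z z := \sum_i L * (rounding (s i z))%:R.
have qf z : q (f z) = expR (- Z z).
  rewrite /q /Z -sumrN expR_sum; apply: eq_bigr => i _.
  by rewrite ffunE code_sizeE.
(* The mean of [Z] is at most [2 (n expR (- L)) (L expR (- L))], where the first bracket is at most
   [k] and the second at most 1. *)
have sum_Z : \sum_z Z z <= #|{ffun 'I_k -> 'I_m}|%:R * (2 * k%:R).
  rewrite /Z exchange_big/=.
  apply: (@le_trans _ _ (\sum_(i < n) L * (m%:R ^+ k * (2 * expR (- (2 * L)))))).
    apply: ler_sum => i _; rewrite -mulr_sumr ler_wpM2l//; first lra.
    exact: sum_rounding_gridpt.
  rewrite sumr_const !card_ord card_ffun !card_ord natrX -[leLHS]mulr_natl.
  have -> : - (2 * L) = - L + - L by ring.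
  have LeL : L * expR (- L) <= 1.
    rewrite expRN ler_pdivrMr ?expR_gt0// mul1r.
    by apply: le_trans (expR_ge1Dx _); lra.
  have -> : n%:R * (L * (m%:R ^+ k * (2 * expR (- L + - L)))) =
      m%:R ^+ k * (2 * ((n%:R * expR (- L)) * (L * expR (- L)))).
    by rewrite expRD; move: (m%:R ^+ k) => M; ring.
  rewrite ler_wpM2l ?exprn_ge0// ler_pM2l//.
  by apply: le_trans nL; rewrite ler_piMr.
(* The constant 6 is 2 from the mean of [Z] plus 4 from the total weight. *)
have := expR_Jensen sum_Z; rewrite card_ffun !card_ord natrX.
under eq_bigr do rewrite -qf.
move=> /le_trans/(_ hc) h.
have {h}h : m%:R ^+ k * expR (- (2 * k%:R)) <= #|[set z | f z == c]%SET|%:R * expR 4 ^+ k :> R.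
  by apply: (le_trans h); rewrite ler_wpM2l.
have e6 : expR (- 6) ^+ k * expR 4 ^+ k = expR (- (2 * k%:R)) :> R.
  by rewrite -!expRM_natl -expRD; congr expR; ring.
by move: h; rewrite -e6 mulrA ler_pM2r// exprn_gt0// expR_gt0.
Qed.

(** * Outer measure from grid counts *)

Lemma compact_nat_cover (T : ptopologicalType) (K : set T) (U : nat -> set T) :
  compact K -> (forall i, open (U i)) -> K `<=` \bigcup_i U i ->
  exists N, forall x, K x -> exists i : 'I_N, U i x.
Proof.
rewrite compact_cover => cK oU KU.
have [D _ KD] := cK nat setT U (fun i _ => oU i) KU.
exists (\max_(i <- finmap.enum_fset D) i).+1 => x /KD [i /= iD Ux].
have iN : (i < (\max_(i <- finmap.enum_fset D) i).+1)%nat by rewrite ltnS leq_bigmax_seq.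
by exists (Ordinal iN).
Qed.

(** The error is linear in [e] with a factor independent of [e]; this controls both the enlargement
    of boxes and the grid discretisation. *)
Lemma prod_addr_le (R : realType) (I : Type) (r : seq I) (l : I -> R) (e : R) :
  (forall i, 0 <= l i) -> 0 <= e <= 1 ->
  \prod_(i <- r) (l i + e) <= \prod_(i <- r) l i + e * \prod_(i <- r) (l i + 1).
Proof.
move=> l0 /andP[e0 e1]; elim: r => [|i r ih].
  by rewrite !big_nil lerDl mulr_ge0.
rewrite !big_cons mulrDl.
have : \prod_(i <- r) (l i + e) <= \prod_(i <- r) (l i + 1).
  by apply: ler_prod => j _; rewrite lerD2l e1 addr_ge0.
have := l0 i; move: ih.
move: (\prod_(i <- r) (l i + e)) (\prod_(i <- r) l i) (\prod_(i <- r) (l i + 1)).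
move=> a b c h i0 ac.
have h1 := ler_wpM2l i0 h; have h2 := ler_wpM2l e0 ac.
by apply: (le_trans (lerD h1 h2)); lra.
Qed.

Lemma boxvol_ge0 k (a b : 'rV[R]_k) : 0 <= boxvol a b.
Proof. by apply: prodr_ge0 => j _; rewrite le_max lexx. Qed.

Lemma boxvol_enlarge k (a b : 'rV[R]_k) (eps : R) : 0 < eps ->
  exists2 e, 0 < e &
    boxvol (a - const_mx e) (b + const_mx e) <= boxvol a b + eps.
Proof.
move=> eps0; pose l j := Num.max 0 (b ord0 j - a ord0 j).
have l0 j : 0 <= l j by rewrite le_max lexx.
pose C := \prod_j (l j + 1).
have C0 : 0 <= C by apply: prodr_ge0 => j _; rewrite addr_ge0.
(* [d] is the total growth of a side, half of it at each end; the [+ 1] keeps the denominator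
   positive. *)
pose d := Num.min 1 (eps / (C + 1)).
have d0 : 0 < d by rewrite lt_min ltr01 divr_gt0//; lra.
have d1 : d <= 1 by rewrite ge_min lexx.
have dC : d * C <= eps.
  apply: (@le_trans _ _ (eps / (C + 1) * (C + 1))).
    apply: ler_pM => //; [exact: ltW| |lra].
    by rewrite ge_min lexx orbT.
  by rewrite divfK// gt_eqF//; lra.
exists (d / 2); first by rewrite divr_gt0.
apply: (@le_trans _ _ (\prod_j (l j + d))).
  apply: ler_prod => j _; rewrite le_max lexx/= ge_max addr_ge0 ?(ltW d0)//=.
  rewrite !mxE /l.
  have : b ord0 j - a ord0 j <= Num.max 0 (b ord0 j - a ord0 j).
    by rewrite le_max lexx orbT.
  move: (Num.max _ _) => y; lra.
apply: (le_trans (prod_addr_le _ l0 _)); first by rewrite ltW.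
by rewrite lerD2l.
Qed.

(** Boxes are closed, so open sets are interposed to make compactness applicable. Balls of row
    vectors are those of the sup norm, hence stay in the enlarged box. *)
Lemma box_enlarge_nbhd k (a b : 'rV[R]_k) (e : R) : 0 < e ->
  exists U : set 'rV[R]_k, [/\ open U, box a b `<=` U &
    U `<=` box (a - const_mx e) (b + const_mx e)].
Proof.
move=> e0; exists (\bigcup_(y in box a b) ball y e); split.
- by apply: bigcup_open => y _; exact: ball_open.
- by move=> y aby; exists y => //; exact: ballxx.
move=> x [y aby [_ yx]] j; rewrite !mxE.
have : `|y ord0 j - x ord0 j| < e := yx ord0 j; rewrite ltr_norml.
have := aby j; lra.
Qed.

Lemma closed_slab (R : realType) k (v : 'rV[R]_k) :
  closed [set x : 'rV[R]_k | `|\sum_(j < k) x ord0 j * v ord0 j| <= 1].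
Proof.
apply: (@preimage_closed _ _ (fun x : 'rV[R]_k => `|\sum_(j < k) x ord0 j * v ord0 j|)
  [set y | y <= 1]); last exact: closed_le.
move=> x _; apply: continuous_comp; last exact: norm_continuous.
move: x; apply: continuous_big => [|j _ y].
  by move=> z; apply: cvgD; [exact: cvg_fst|exact: cvg_snd].
have c := @coord_continuous R 1 k ord0 j y.
by apply: cvgM c (cvg_cst _).
Qed.

Lemma slab_body_closed k n (u : 'I_n -> 'rV[R]_k) : closed (slab_body u).
Proof.
have -> : slab_body u = \bigcap_(i in setT) [set x | `|dotR x (u i)| <= 1].
  by apply/seteqP; split => x /= h i; [move=> _|]; exact: h.
by apply: closed_bigI => i _; exact: closed_slab.
Qed.

(** The rescaled midpoints have spacing [2 / (m w)]. Offsets from the least index [y] in the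
    interval are distinct and at most length over spacing; the offset 0 accounts for the extra
    term. *)
Lemma card_midpoint_itv (R : realType) m (w a b c : R) : (0 < m)%nat -> 0 < w ->
  2 / (m%:R * w) * #|[pred z : 'I_m | a <= (midpoint z - c) / w <= b]|%:R
    <= Num.max 0 (b - a) + 2 / (m%:R * w).
Proof.
move=> m0 w0; set P := [pred z | _]; set h := 2 / _.
have mR : 0 < (m%:R : R) by rewrite ltr0n.
have h0 : 0 < h by rewrite divr_gt0 ?mulr_gt0.
have max0 : 0 <= Num.max 0 (b - a) by rewrite le_max lexx.
have [z0 Pz0|P0] := pickP P; last first.
  by rewrite (eq_card0 P0) mulr0 addr_ge0// ltW.
have [y Py ymin] := arg_minnP (fun z : 'I_m => z : nat) Pz0.
have q0 : 0 <= Num.max 0 (b - a) / h by rewrite divr_ge0// ltW.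
set d := Num.trunc (Num.max 0 (b - a) / h).
have dP z : P z -> (z - y <= d)%nat.
  move=> Pz; rewrite /d (truncn_ge_nat _ q0) ler_pdivlMr//.
  rewrite le_max; apply/orP; right.
  have -> : (z - y)%:R * h = (midpoint z - c) / w - (midpoint y - c) / w.
    rewrite natrB ?ymin// /h /midpoint.
    by field; rewrite !gt_eqF.
  by move: Pz Py => /andP[? ?] /andP[? ?]; lra.
have : (#|P| <= d.+1)%nat.
  rewrite -[d.+1]card_ord -(@card_in_imset _ _ (fun z : 'I_m => inord (z - y) : 'I_d.+1)).
    exact: max_card.
  move=> z1 z2 P1 P2 /(congr1 val) /=; rewrite !inordK ?ltnS ?dP// => e.
  by apply/val_inj; rewrite /= -(subnK (ymin _ P1)) e subnK ?ymin.
rewrite -(ler_nat R) => /(ler_wpM2l (ltW h0)) /le_trans; apply.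
rewrite -[d.+1%:R]natr1 mulrDr mulr1 lerD2r mulrC -ler_pdivlMr//.
by rewrite truncn_le.
Qed.

Lemma card_gridpt_box k m (w : R) (a b x0 : 'rV[R]_k) : (0 < m)%nat -> 0 < w ->
  (2 / (m%:R * w)) ^+ k *
    #|[pred z : {ffun 'I_k -> 'I_m} |
        [forall j, a ord0 j <= (midpoint (z j) - x0 ord0 j) / w <= b ord0 j]]|%:R
    <= \prod_j (Num.max 0 (b ord0 j - a ord0 j) + 2 / (m%:R * w)).
Proof.
move=> m0 w0.
pose F j := [pred z : 'I_m |
  a ord0 j <= (midpoint z - x0 ord0 j) / w <= b ord0 j].
rewrite (eq_card (B := family F)); last first.
  by move=> z; rewrite !inE.
rewrite card_family foldrE big_map big_enum/= natr_prod.
rewrite -[k in _ ^+ k]card_ord -prodr_const -big_split/=.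
apply: ler_prod => j _; rewrite card_midpoint_itv// andbT.
by rewrite mulr_ge0// divr_ge0// mulr_ge0// ltW.
Qed.

(** Every point of [S] falls into some box, and a box holds at most its volume over [h^k] rescaled
    grid points, up to an error that vanishes with the spacing [h]. *)
Lemma grid_dense_boxes k (w v : R) (K : set 'rV[R]_k) N (a b : 'I_N -> 'rV[R]_k) :
  0 < w ->
  (forall m, (0 < m)%nat ->
    exists (S : {set {ffun 'I_k -> 'I_m}}) (x0 : 'rV[R]_k),
      (forall z, z \in S -> K (w^-1 *: (gridpt z - x0))) /\
      v <= (2 / (m%:R * w)) ^+ k * #|S|%:R) ->
  (forall x, K x -> exists i, box (a i) (b i) x) ->
  v <= \sum_i boxvol (a i) (b i).
Proof.
move=> w0 grid cover.
pose l i j := Num.max 0 (b i ord0 j - a i ord0 j).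
have l0 i j : 0 <= l i j by rewrite le_max lexx.
pose C := \sum_i \prod_j (l i j + 1).
have C0 : 0 <= C.
  by apply: sumr_ge0 => i _; apply: prodr_ge0 => j _; rewrite addr_ge0.
apply/ler_addgt0Pr => e e0.
(* This mesh gives [h (C / e + 1) <= 1], hence both [h <= 1] and [h C <= e]. *)
pose m := (Num.trunc (2 * (C / e + 1) / w)).+1.
have m0 : (0 < m)%nat by [].
pose h := 2 / (m%:R * w).
have Ce : 1 <= C / e + 1 by rewrite lerDr divr_ge0// ltW.
have mw : 2 * (C / e + 1) <= m%:R * w.
  by rewrite -ler_pdivrMr// ltW// truncnS_gt.
have mw0 : 0 < m%:R * w by lra.
have hC : h * (C / e + 1) <= 1.
  by rewrite /h mulrAC ler_pdivrMr// mul1r.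
have h0 : 0 < h by rewrite divr_gt0.
have h1 : h <= 1 by apply: le_trans hC; rewrite ler_peMr// ltW.
have h01 : 0 <= h <= 1 by rewrite h1 ltW.
have hCe : h * C <= e.
  have -> : h * C = h * (C / e + 1) * e - h * e by field; rewrite gt_eqF.
  nra.
have [S [x0 [SK vS]]] := grid m m0.
apply: (le_trans vS).
pose P i := [pred z : {ffun 'I_k -> 'I_m} | [forall j,
  a i ord0 j <= (midpoint (z j) - x0 ord0 j) / w <= b i ord0 j]].
have SP : (#|S| <= \sum_i #|P i|)%nat.
  rewrite -sum1_card.
  apply: (@leq_trans (\sum_(z in S) \sum_i (z \in P i))).
    apply: leq_sum => z /SK /cover [i zi]; rewrite (bigD1 i)//= inE.
    suff -> : [forall j, a i ord0 j <= (midpoint (z j) - x0 ord0 j) / w <= b i ord0 j].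
      by [].
    by apply/forallP => j; have := zi j; rewrite !mxE mulrC.
  rewrite exchange_big/=; apply: leq_sum => i _.
  rewrite -sum1_card [leqRHS]big_mkcond [leqLHS]big_mkcond/=; apply: leq_sum => z _.
  by case: (z \in S); case: (z \in P i).
have h0k : 0 <= h ^+ k by rewrite exprn_ge0// ltW.
apply: (@le_trans _ _ (h ^+ k * (\sum_i #|P i|)%:R)).
  by rewrite ler_wpM2l// ler_nat.
rewrite natr_sum mulr_sumr.
apply: (@le_trans _ _ (\sum_i (\prod_j l i j + h * \prod_j (l i j + 1)))).
  apply: ler_sum => i _; apply: le_trans (card_gridpt_box _ _ _ m0 w0) _.
  exact: (prod_addr_le _ (l0 i) h01).
by rewrite big_split/= -mulr_sumr lerD2l.
Qed.

(** Enlarging the [i]-th box of a countable cover at a cost of [eps / 2^(i+1)] gives room for an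
    open cover; a finite subcover reduces the claim to [grid_dense_boxes]. *)
Lemma leb_vol_ge_grid k (w v : R) (K : set 'rV[R]_k) :
  compact K -> 0 < w ->
  (forall m, (0 < m)%nat ->
    exists (S : {set {ffun 'I_k -> 'I_m}}) (x0 : 'rV[R]_k),
      (forall z, z \in S -> K (w^-1 *: (gridpt z - x0))) /\
      v <= (2 / (m%:R * w)) ^+ k * #|S|%:R) ->
  (v%:E <= leb_vol K)%E.
Proof.
move=> cK w0 grid; apply/ereal_infP => _ [a [b [Kab ->]]].
apply/lee_addgt0Pr => eps eps0.
have eps_i i : 0 < eps / (expn 2 i.+1)%:R by rewrite divr_gt0// ltr0n expn_gt0.
have /choice[e eP] i : exists e, 0 < e /\
    boxvol (a i - const_mx e) (b i + const_mx e)
      <= boxvol (a i) (b i) + eps / (expn 2 i.+1)%:R.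
  by have [e] := boxvol_enlarge (a i) (b i) (eps_i i); exists e.
have /choice[U UP] i := box_enlarge_nbhd (a i) (b i) (eP i).1.
have [N KN] : exists N, forall x, K x -> exists i : 'I_N, U i x.
  apply: compact_nat_cover cK _ _ => [i|x /Kab [i _ abx]]; first by have [] := UP i.
  by exists i => //; have [_ + _] := UP i; apply.
have hv : v <= \sum_(i < N) boxvol (a i - const_mx (e i)) (b i + const_mx (e i)).
  apply: (grid_dense_boxes w0 grid) => x /KN [i Ux]; exists i.
  by have [_ _] := UP i; apply.
apply: (@le_trans _ _ (\sum_(0 <= i < N)
    ((boxvol (a i) (b i))%:E + (eps / (expn 2 i.+1)%:R)%:E))%E).
  under eq_bigr do rewrite -EFinD.
  rewrite sumEFin lee_fin big_mkord; apply: (le_trans hv).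
  by apply: ler_sum => i _; exact: (eP i).2.
apply: (@le_trans _ _ (\sum_(0 <= i <oo)
    ((boxvol (a i) (b i))%:E + (eps / (expn 2 i.+1)%:R)%:E))%E).
  apply: nneseries_lim_ge => i _ _.
  by rewrite -EFinD lee_fin addr_ge0 ?boxvol_ge0 ?ltW.
by apply: epsilon_trick => [i|]; rewrite ?lee_fin ?boxvol_ge0 ?ltW.
Qed.

(** * Volume of the slab body *)

Lemma compact_unit_cube (R : realType) k :
  compact [set x : 'rV[R]_k | forall j, -1 <= x ord0 j <= 1].
Proof.
have -> : [set x : 'rV[R]_k | forall j, -1 <= x ord0 j <= 1] =
    [set x | forall j, `[-1, 1]%classic (x ord0 j)].
  by apply/seteqP; split => x h j; have := h j; rewrite /= in_itv.
by apply: (@rV_compact R k (fun=> `[-1, 1]%classic)) => j; exact: segment_compact.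
Qed.

Lemma le_leb_vol k (A B : set 'rV[R]_k) : A `<=` B -> (leb_vol A <= leb_vol B)%E.
Proof.
move=> AB; apply/ereal_infP => _ [a [b [Bab ->]]]; apply: ereal_inf_lbound.
by exists a, b; split => //; exact: subset_trans Bab.
Qed.

Lemma slab_body_vol_ge k n (L : R) (u : 'I_n -> 'rV[R]_k) :
  1 <= L -> n%:R * expR (- L) <= k%:R -> (forall i, enorm (u i) <= 1) ->
  (((expR (- 6) / 4 / Num.sqrt L) ^+ k)%:E <= leb_vol (slab_body u))%E.
Proof.
move=> L1 nL u1; set w := 8 * Num.sqrt L.
have sL : 1 <= Num.sqrt L by rewrite -[leLHS]sqrtr1 ler_sqrt; lra.
have w0 : 0 < w by rewrite /w; lra.
(* The slab body is unbounded when the [u i] do not span, so it is cut by a cube to obtain a compact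
   set. *)
set Q := [set x : 'rV[R]_k | forall j, -1 <= x ord0 j <= 1].
have cK : compact (slab_body u `&` Q).
  apply: (@subclosed_compact _ _ Q) => //; last exact: compact_unit_cube.
  apply: closedI; first exact: slab_body_closed.
  apply: compact_closed; [exact: norm_hausdorff|exact: compact_unit_cube].
apply: (@le_trans _ _ (leb_vol (slab_body u `&` Q))); last first.
  by apply: le_leb_vol => x [].
apply: (leb_vol_ge_grid cK w0) => m m0.
have [S [cardS cellS]] := exists_large_cell m L1 nL u1.
have mR : 0 < (m%:R : R) by rewrite ltr0n.
have /card_gt0P[z0 z0S] : (0 < #|S|)%nat.
  rewrite -(ltr0n R); apply: lt_le_trans cardS.
  by rewrite mulr_gt0// exprn_gt0// expR_gt0.
(* Translating by a point of the cell itself turns its points into differences, which lie in [w]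
   times the slab body. The constant is [2 / (8 sqrt L)] times [expR (- 6)]. *)
exists S, (gridpt z0); split; last first.
  have h0 : 0 <= (2 / (m%:R * w)) ^+ k by rewrite exprn_ge0// divr_ge0// mulr_ge0// ltW.
  apply: le_trans (ler_wpM2l h0 cardS).
  rewrite -!exprMn le_eqVlt; apply/orP; left; apply/eqP; congr (_ ^+ _).
  by rewrite /w; field; rewrite !gt_eqF//; lra.
move=> z zS; split => [i|j]; last first.
  rewrite -ler_norml !mxE normrM normfV (gtr0_norm w0) mulrC.
  rewrite ler_pdivrMr// mul1r; apply: (le_trans (ler_normB _ _)).
  apply: (le_trans (lerD (midpoint_norm_le1 _ _) (midpoint_norm_le1 _ _))).
  by rewrite /w; lra.
have -> : dotR (w^-1 *: (gridpt z - gridpt z0)) (u i) =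
    (dotR (gridpt z) (u i) - dotR (gridpt z0) (u i)) / w.
  rewrite /dotR -sumrB mulr_suml; apply: eq_bigr => j _.
  by rewrite !mxE; ring.
by rewrite normrM normfV (gtr0_norm w0) ler_pdivrMr// mul1r cellS.
Qed.

Theorem theorem1 :
  exists delta : R, 0 < delta /\
  forall (k n : nat), (1 <= k <= n)%nat ->
  forall u : 'I_n -> 'rV[R]_k,
    (forall i, enorm (u i) <= 1) ->
    ((delta / Num.sqrt (1 + ln (n%:R / k%:R)))%:E
       <= poweR (leb_vol (slab_body u)) (k%:R)^-1)%E.
Proof.
exists (expR (- 6) / 4); split; first by rewrite divr_gt0// expR_gt0.
move=> k n /andP[k0 kn] u u1.
have kR : 0 < (k%:R : R) by rewrite ltr0n.
have nR : 0 < (n%:R : R) by rewrite ltr0n (leq_trans k0).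
set L := 1 + ln (n%:R / k%:R).
have L1 : 1 <= L by rewrite lerDl ln_ge0// ler_pdivlMr// mul1r ler_nat.
(* By the choice of [L] the left side equals [k / e]. *)
have nL : n%:R * expR (- L) <= k%:R.
  have e1 : expR (- 1) <= 1 :> R by rewrite expR_le1; lra.
  have -> : n%:R * expR (- L) = k%:R * expR (- 1).
    rewrite /L opprD expRD [expR (- ln _)]expRN lnK ?posrE ?divr_gt0//.
    by field; rewrite !gt_eqF.
  by rewrite ler_piMr// ltW.
set x := _ / _.
have x0 : 0 <= x by rewrite !divr_ge0// ?expR_ge0// sqrtr_ge0.
have xk : poweR (x ^+ k)%:E k%:R^-1 = x%:E.
  by rewrite poweR_EFin -powR_mulrn// -powRrM mulfV ?gt_eqF// powRr1.
rewrite -xk; apply: gt0_ler_poweR.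
- by rewrite invr_ge0 ltW.
- by rewrite in_itv/= lee_fin exprn_ge0//= leey.
- rewrite in_itv/= leey andbT; apply: le_trans (slab_body_vol_ge L1 nL u1).
  by rewrite lee_fin exprn_ge0.
- exact: slab_body_vol_ge.
Qed.
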